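(* Let $G$ be a rectifiable space. Then $G$ contains a copy of $S_\omega$ if and only if $G$ contains a copy of $S_2$; and $G$ contains a closed copy of $S_\omega$ if and only if $G$ contains a closed copy of $S_2$.
   Context: All spaces are assumed to be $T_1$ and regular. A topological space $G$ is a rectifiable space if there are a surjective homeomorphism $\varphi: G\times G\to G\times G$ and an element $e\in G$ such that $\pi_1\circ\varphi=\pi_1$ and $\varphi(x,x)=(x,e)$ for every $x\in G$, where $\pi_1:G\times G\to G$ is the projection to the first coordinate. A (closed) copy of a space $S$ in $G$ is a (closed) subspace of $G$ homeomorphic to $S$. $S_\omega$ is the space obtained from the topological sum of $\omega$ many (non-trivial) convergent sequences, each taken with its limit point, by identifying all the limit points to one point (quotient topology). $S_2$ (Arens' space) is the set $\{\infty\}\cup\{x_n:n\in\mathbb{N}\}\cup\{x_n(m):m,n\in\mathbb{N}\}$ (all points distinct) with the following topology: each $x_n(m)$ is isolated; a basic neighborhood of $x_n$ is $\{x_n\}\cup\{x_n(m):m>k\}$ for some $k\in\mathbb{N}$; a basic neighborhood of $\infty$ is $\{\infty\}\cup\bigcup\{V_n:n>k\}$ for some $k\in\mathbb{N}$, where each $V_n$ is a (basic) neighborhood of $x_n$. *)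

(* Defs.v *)
From HB Require Import structures.
From mathcomp Require Import all_boot all_order all_algebra.
From mathcomp Require Import all_classical.
From mathcomp Require Import topology wedge_sigT.

Set Implicit Arguments.
Unset Strict Implicit.
Unset Printing Implicit Defensive.

Local Open Scope classical_set_scope.

Definition homeomorphism (X Y : topologicalType) (f : X -> Y) : Prop :=
  exists g : Y -> X, [/\ cancel f g, cancel g f, continuous f & continuous g].

Definition homeomorphic (X Y : topologicalType) : Prop :=
  exists f : X -> Y, homeomorphism f.

Definition rectifiable (G : topologicalType) : Prop :=
  exists (phi : (G * G)%type -> (G * G)%type) (e : G),
    [/\ homeomorphism phi,
        forall p, (phi p).1 = p.1 &
        forall x, phi (x, x) = (x, e)].

(* [set_type A] carries the subspace topology, unlike the library's
   [subspace A], whose carrier is the whole ambient type. *)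
Definition has_copy (S G : topologicalType) : Prop :=
  exists A : set G, homeomorphic (set_type A) S.

Definition has_closed_copy (S G : topologicalType) : Prop :=
  exists2 A : set G, closed A & homeomorphic (set_type A) S.

(* The compact subsets of the discrete space nat are the finite ones, so its
   one-point compactification is a non-trivial convergent sequence
   [Some 0, Some 1, ...] together with its limit [None]. *)
Definition convergent_sequence : topologicalType :=
  one_point_compactification nat.

(* [wedge p0] is the topological sum of the spaces, with the points [p0 i]
   identified, in the quotient topology. *)
Definition S_omega : topologicalType :=
  @wedge nat (fun=> convergent_sequence) (fun=> None).

Inductive arens : Type :=
| arens_infty
| arens_x of nat
| arens_xx of nat & nat.

HB.instance Definition _ := gen_eqMixin arens.
HB.instance Definition _ := gen_choiceMixin arens.

Definition arens_basic_x (n k : nat) : set arens :=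
  [set arens_x n] `|` [set arens_xx n m | m in [set m | (k < m)%N]].

(* [h n] selects the basic neighborhood [V_n] of [x_n]. *)
Definition arens_basic_infty (kh : nat * (nat -> nat)) : set arens :=
  [set arens_infty] `|`
  \bigcup_(n in [set n | (kh.1 < n)%N]) arens_basic_x n (kh.2 n).

Definition arens_nbhs (p : arens) : set_system arens :=
  match p with
  | arens_infty => filter_from setT arens_basic_infty
  | arens_x n => filter_from setT (arens_basic_x n)
  | arens_xx n m => principal_filter (arens_xx n m)
  end.

Local Lemma arens_basic_x_sub n k k' :
  (k <= k')%N -> arens_basic_x n k' `<=` arens_basic_x n k.
Proof.
move=> kk' _ [->|[m /= km <-]]; first by left.
by right; exists m => //=; exact: leq_ltn_trans km.
Qed.

Local Lemma arens_nbhs_filter (p : arens) : ProperFilter (arens_nbhs p).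
Proof.
case: p => [|n|n m] /=; last exact: principal_filter_proper.
- apply: filter_from_proper; last by move=> kh _; exists arens_infty; left.
  apply: filter_from_filter; first by exists (0%N, fun=> 0%N).
  move=> [k h] [k' h'] _ _.
  exists (maxn k k', fun n => maxn (h n) (h' n)) => // p [->|[n /= kn pV]].
    by split; left.
  move: kn; rewrite gtn_max => /andP[kn k'n].
  by split; right; exists n => //=; apply: arens_basic_x_sub pV;
    rewrite ?leq_maxl ?leq_maxr.
- apply: filter_from_proper; last by move=> k _; exists (arens_x n); left.
  apply: filter_from_filter; first by exists 0%N.
  move=> k k' _ _; exists (maxn k k') => // p pV.
  by split; apply: arens_basic_x_sub pV; rewrite ?leq_maxl ?leq_maxr.
Qed.

Local Lemma arens_nbhs_singleton (p : arens) (A : set arens) :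
  arens_nbhs p A -> A p.
Proof.
case: p => [|n|n m] /=.
- by move=> [kh _]; apply; left.
- by move=> [k _]; apply; left.
- by move=> /principal_filterP.
Qed.

Local Lemma arens_nbhs_nbhs (p : arens) (A : set arens) :
  arens_nbhs p A -> arens_nbhs p (arens_nbhs^~ A).
Proof.
have basic n k : arens_basic_x n k `<=` A ->
    arens_basic_x n k `<=` arens_nbhs^~ A.
  move=> kA _ [->|[m km <-]]; first by exists k.
  by apply/principal_filterP/kA; right; exists m.
case: p => [|n|n m] /=.
- move=> [[k h] _ khA]; exists (k, h) => // p [->|[n kn nV]].
    by exists (k, h).
  by apply: basic nV => q nq; apply: khA; right; exists n.
- by move=> [k _ kA]; exists k => //; exact: basic.
- by move=> ?; exact/principal_filterP.
Qed.

HB.instance Definition _ := hasNbhs.Build arens arens_nbhs.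
HB.instance Definition _ := @Nbhs_isNbhsTopological.Build arens
  arens_nbhs_filter arens_nbhs_singleton arens_nbhs_nbhs.

Definition S_two : topologicalType := arens.

(* Main.v *)
Require Import Defs.
From mathcomp Require Import all_boot all_order all_algebra.
From mathcomp Require Import all_classical.
From mathcomp Require Import topology wedge_sigT.

Set Implicit Arguments.
Unset Strict Implicit.
Unset Printing Implicit Defensive.

Local Open Scope classical_set_scope.

(** In a rectifiable space [G], write [phi (b, x) = (b, q (b, x))] and
[phi^-1 (b, x) = (b, p (b, x))].  For a fixed base point [a], the maps
[S (b, x) = p (b, q (a, x))] and [T (b, x) = p (a, q (b, x))] are jointly
continuous, [S (b, _)] and [T (b, _)] are inverse to each other, [S (b, _)]
sends [a] to [b], and [S (a, _)] is the identity ([rectifiable_translations]).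
They play the part of the left translations by [b * a^-1] and [a * b^-1] in a
topological group.  Joint continuity at the points [(a, z)], where both maps
return [z], says that these translations tend to the identity as [b] tends to
[a].

Both [S_omega] and [S_two] contain countably many columns of isolated points,
converging to the centre in [S_omega] and to the points [x_n] in [S_two], and
in both a set of isolated points that meets every column in a finite set does
not accumulate at the centre.

- Given [S_omega] at [a] with columns [C n m --> a], take a sequence
  [x n --> a] inside the column [C 0] and translate the [n]-th column to
  [x n]: [y n m = S (x n, C n m) --> x n].  If a columnwise finite family of
  the [y n m] accumulated at [a], then, applying [T (x n, _)], which tends to
  the identity, the corresponding [C n m] would accumulate at [a] as well.
- Given [S_two] with [x n --> a] and [z n m --> x n], translate each column
  back to [a]: [y n m = T (x n, z n m) --> a].  If a columnwise finite family
  of the [y n m] accumulated at [a], so would the corresponding [z n m], on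
  applying [S (x n, _)].

Points of different columns may interfere after translation: they may
coincide or accumulate at one another.  This is repaired by thinning out,
which preserves columnwise finiteness: [discrete_selection] picks one point
from each of countably many sequences converging to [a] so that the chosen
points have pairwise disjoint neighbourhoods, each staying away from [a].

For closed copies, let [z <> a] be a limit of the new copy.  As the
translations attached to [x n] tend to the identity, the points of the new
copy near [z] come, up to finitely many columns, from points of the old copy
near [z].  When the old copy is a closed [S_omega], only one of its points can
be near [z <> a].  When it is a closed [S_two], the new points near [z] stay
away from [a], so they and their originals are columnwise finite, and such a
set accumulates nowhere in [S_two].  In both cases finitely many convergent
sequences accumulate at [z], so [z] already belongs to the new copy. *)

(** * Sequences in Hausdorff spaces *)

Lemma filter_below (T : Type) (F : set_system T) (P : nat -> set T) n :
  Filter F -> (forall i, (i < n)%N -> F (P i)) ->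
  F [set x | forall i, (i < n)%N -> P i x].
Proof.
move=> FF; elim: n => [|n IH] FP; first exact: filterE.
have Fn := FP n (ltnSn n).
have := IH (fun i ltin => FP i (ltnW ltin)).
move=> Flt; apply: filterS (filterI Fn Flt) => x [Pn Plt] i.
by rewrite ltnS leq_eqVlt => /predU1P[->//|/Plt].
Qed.

(** Dependent choice where each choice may look at all the earlier ones. *)
Lemma greedy_sequence (P : seq nat -> nat -> Prop) :
  (forall l, exists m, P l m) ->
  exists M : nat -> nat, forall s, P (mkseq M s) (M s).
Proof.
move=> /choice[c cP].
pose L := fix L s := if s is s'.+1 then rcons (L s') (c (L s')) else [::].
exists (c \o L) => s; suff -> : mkseq (c \o L) s = L s by exact: cP.
by elim: s => [//|s IH]; rewrite mkseqS IH.
Qed.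

Lemma closedP (G : topologicalType) (A : set G) :
  (forall z, ~ A z -> nbhs z (~` A)) -> closed A.
Proof.
move=> AN z clz; apply: contrapT => nAz.
by have [y [Ay /(_ Ay)]] := clz _ (AN z nAz).
Qed.

Section Hausdorff.
Variable G : topologicalType.

Lemma T1_regular_hausdorff :
  accessible_space G -> regular_space G -> hausdorff_space G.
Proof.
move=> T1 reg p q clpq; apply/eqP/negPn/negP => pq.
have [U [oU /set_mem Up /set_mem Uq]] := T1 _ _ pq.
have [B pB clB] := reg p U (open_nbhs_nbhs (conj oU Up)).
by apply/Uq/clB => V qV; have [z [Bz Vz]] := clpq B V pB qV; exists z.
Qed.

Hypothesis hG : hausdorff_space G.

Lemma hausdorff_separate (x y : G) : x <> y ->
  exists UV : set G * set G,
    [/\ nbhs x UV.1, nbhs y UV.2 & forall z, UV.1 z -> UV.2 z -> False].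
Proof.
move=> xy; apply: contrapT => noUV; apply/xy/hG => U V xU yV.
apply: contrapT => UV0; apply: noUV; exists (U, V); split => // z Uz Vz.
by apply: UV0; exists z.
Qed.

Lemma nbhs_neq (x y : G) : x <> y -> nbhs x [set z | z <> y].
Proof.
move=> /hausdorff_separate[[U V] /= [xU yV UV]].
apply: filterS xU => z Uz zy; apply: (UV z) => //.
by rewrite zy; exact: nbhs_singleton.
Qed.

(** A convergent sequence together with its limit is closed. *)
Lemma nbhs_avoid_cvg (u : nat -> G) (l z : G) : u @ \oo --> l ->
  z <> l -> (forall m, u m <> z) -> nbhs z [set v | forall m, u m <> v].
Proof.
move=> ul zl uz; have [[U V] /= [zU lV UV]] := hausdorff_separate zl.
have [N _ NV] := ul _ lV.
have below : nbhs z [set v | forall m, (m < N)%N -> u m <> v].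
  apply: filter_below => m _.
  have := nbhs_neq (nesym (uz m)).
  by apply: filterS => v ne /esym.
apply: filterS (filterI zU below) => v [Uv bv] m umv.
have [/bv//|Nm] := ltnP m N; apply: (UV v) => //.
by rewrite -umv; apply: NV.
Qed.

(** Each chosen point is separated from [a] by a pair of disjoint
neighbourhoods; as the later sequences all converge to [a], every later point
can be taken in the half around [a] of each of the earlier pairs.  The lower
bound [h] serves to keep the selected indices unbounded when the sequences
[u s] are repetitions of the same ones. *)
Lemma discrete_selection (a : G) (u : nat -> nat -> G) (h : nat -> nat) :
  (forall s, u s @ \oo --> a) -> (forall s m, u s m <> a) ->
  exists (M : nat -> nat) (D : nat -> set G),
    [/\ forall s, (h s <= M s)%N,
        forall s, open_nbhs (u s (M s)) (D s),
        forall s, nbhs a (~` D s) &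
        forall r s p, D r p -> D s p -> r = s].
Proof.
move=> ua una.
have /choice[OU OUP] : forall z, exists OU : set G * set G, z <> a ->
    [/\ nbhs z OU.1, nbhs a OU.2 & forall z, OU.1 z -> OU.2 z -> False].
  move=> z; have [->|za] := pselect (z = a); first by exists (setT, setT).
  by have [OU] := hausdorff_separate za; exists OU.
have [|M MP] := @greedy_sequence (fun l m => (h (size l) <= m)%N /\
    forall r, (r < size l)%N ->
      nbhs (u (size l) m) (OU (u r (nth 0%N l r))).2).
  move=> l.
  have [N _ NP] : \forall m \near \oo, (h (size l) <= m)%N /\
      forall r, (r < size l)%N ->
        nbhs (u (size l) m) (OU (u r (nth 0%N l r))).2.
    apply: filterI; first exact: nbhs_infty_ge.
    apply: (@filter_below _ _ (fun r m =>
      nbhs (u (size l) m) (OU (u r (nth 0%N l r))).2)) => r _.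
    by have [_ /nbhs_interior/(ua (size l))] := OUP _ (una r (nth 0%N l r)).
  by exists N; apply: NP => /=.
pose w s := u s (M s).
(* D s: the half around w s, cut down to the halves around a of the earlier
   pairs, so that it is disjoint from the earlier D r. *)
exists M, (fun s => ((OU (w s)).1 `&`
    [set p | forall r, (r < s)%N -> (OU (w r)).2 p])°).
have lt_disj r s p : (r < s)%N -> (OU (w r)).1 p -> (OU (w r)).2 p -> False.
  by have [_ _] := OUP _ (una r (M r)) => + _; apply.
split=> [s|s|s|r s p /nbhs_singleton[Or Ur] /nbhs_singleton[Os Us]].
- by have := (MP s).1; rewrite size_mkseq.
- split; first exact: open_interior.
  apply: filterI; first by have [] := OUP _ (una s (M s)).
  apply: filter_below => r rs.
  by have := (MP s).2 r; rewrite size_mkseq nth_mkseq //; apply.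
- have [_ aU dis] := OUP _ (una s (M s)).
  apply: filterS aU => p Up /nbhs_singleton[Op _].
  exact: dis Up.
- case: (ltngtP r s) => // [rs|sr].
  + by case: (lt_disj _ _ p rs Or (Us _ rs)).
  + by case: (lt_disj _ _ p sr Os (Ur _ sr)).
Qed.

End Hausdorff.

(** * Translations of a rectifiable space *)

Section Rectifiable.
Variable G : topologicalType.

Lemma continuous_pair_nbhs (T : G * G -> G) (b x : G) (W : set G) :
  continuous T -> nbhs (T (b, x)) W ->
  exists U V, [/\ nbhs b U, nbhs x V & forall c y, U c -> V y -> W (T (c, y))].
Proof.
move=> cT /cT[[U V] /= [bU xV] UVW]; exists U, V; split => // c y Uc Vy.
exact: (UVW (c, y)).
Qed.

Lemma continuous_pair_slice (T : G * G -> G) (b x : G) (W : set G) :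
  continuous T -> nbhs (T (b, x)) W -> nbhs x [set y | W (T (b, y))].
Proof.
move=> cT /(continuous_pair_nbhs cT)[U [V [bU xV UVW]]].
by apply: filterS xV => y; apply: UVW; apply: nbhs_singleton.
Qed.

(** [q (x, x) = e] makes [q (a, _)] and [p (b, _)] send [a] to [e] and [e] to
[b], so their composite carries [a] to [b]; at [b = a] they cancel. *)
Lemma rectifiable_translations (a : G) : rectifiable G ->
  exists S T : G * G -> G,
    [/\ continuous S, continuous T,
        (forall b x, S (b, T (b, x)) = x) /\ (forall b x, T (b, S (b, x)) = x),
        forall b, S (b, a) = b & forall x, S (a, x) = x].
Proof.
move=> [phi [e [[psi [phiK psiK cphi cpsi]] phi1 phie]]].
have psi1 z : (psi z).1 = z.1 by rewrite -[in RHS](psiK z) phi1.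
pose q z := (phi z).2; pose p z := (psi z).2.
have phiE b x : phi (b, x) = (b, q (b, x)).
  by rewrite [LHS]surjective_pairing phi1.
have psiE b x : psi (b, x) = (b, p (b, x)).
  by rewrite [LHS]surjective_pairing psi1.
have pq b x : p (b, q (b, x)) = x by rewrite /p -phiE phiK.
have qp b x : q (b, p (b, x)) = x by rewrite /q -psiE psiK.
have qxx x : q (x, x) = e by rewrite /q phie.
have cq : continuous q.
  by move=> z; apply: continuous_comp; [exact: cphi | exact: cvg_snd].
have cp : continuous p.
  by move=> z; apply: continuous_comp; [exact: cpsi | exact: cvg_snd].
have pairing (r : G * G -> G) (s : G * G -> G * G) : continuous r ->
    (forall z, {for z, continuous (fun z => (s z).1)}) ->
    (forall z, {for z, continuous (fun z => (s z).2)}) ->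
    continuous (fun z => r (s z)).
  move=> cr cs1 cs2 z; apply: (@continuous_comp _ _ _ s r); last exact: cr.
  have sE : s = fun x => ((s x).1, (s x).2).
    by apply/funext => x; rewrite -surjective_pairing.
  rewrite /prop_for /continuous_at sE [X in _ --> X]/=.
  exact: (cvg_pair (cs1 z) (cs2 z)).
exists (fun z => p (z.1, q (a, z.2))), (fun z => p (a, q (z.1, z.2))).
split.
- apply: (@pairing p (fun z => (z.1, q (a, z.2)))) => // z.
    exact: cvg_fst.
  apply: (@pairing q (fun z => (a, z.2))) => // {}z; first exact: cvg_cst.
  exact: cvg_snd.
- apply: (@pairing p (fun z => (a, q (z.1, z.2)))) => // z.
    exact: cvg_cst.
  apply: (@pairing q (fun z => (z.1, z.2))) => // {}z; first exact: cvg_fst.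
  exact: cvg_snd.
- by split=> b x /=; rewrite ?qp ?pq // pq.
- by move=> b; rewrite /= qxx -(qxx b) pq.
- by move=> x /=; rewrite pq.
Qed.

End Rectifiable.

(** * Copies as embeddings *)

Section Embedding.
Variables S G : topologicalType.

(** A homeomorphism onto the image, in terms of neighbourhoods of points: both
model spaces are given by neighbourhood bases. *)
Definition embedding (f : S -> G) : Prop :=
  injective f /\
  forall s N, nbhs s N <-> exists2 W, nbhs (f s) W & f @^-1` W `<=` N.

Lemma embeddingP (f : S -> G) :
  injective f -> continuous f ->
  (forall s N, nbhs s N -> exists2 W, nbhs (f s) W & f @^-1` W `<=` N) ->
  embedding f.
Proof.
move=> finj fc fN; split=> // s N; split=> [/fN //|[W sW sub]].
exact: (filterS sub (fc s W sW)).
Qed.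

Lemma embedding_continuous (f : S -> G) : embedding f -> continuous f.
Proof. by move=> [_ fN] s W sW; apply/fN; exists W. Qed.

(** Copies and closed copies are the cases [P = setT] and [P = closed]. *)
Lemma copy_embedding (P : set (set G)) :
  (exists2 A, P A & homeomorphic (set_type A) S) <->
  (exists2 f : S -> G, embedding f & P (range f)).
Proof.
split=> [[A PA [h [g [hK gK ch cg]]]]|[f [finj fN] Pf]].
- exists (fun s => set_val (g s)).
  + split=> [s t /val_inj /(can_inj gK) //|s N]; split.
    * move=> sN.
      have : nbhs (h (g s)) N by rewrite gK.
      move=> /ch [_ [[W oW <-] /= Wgs sub]].
      exists W; first exact: open_nbhs_nbhs.
      by move=> t /= Wgt; rewrite -(gK t); apply: sub.
    * move=> [W sW sub]; apply: (filterS sub).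
      apply: (cg s (set_val @^-1` W)).
      exact: (@initial_continuous _ _ (set_val : A -> G)).
  + suff -> : range (fun s => set_val (g s)) = A by [].
    apply/seteqP; split=> [_ [s _ <-]|x Ax].
      exact/set_mem/valP.
    exists (h (SigSub (mem_set Ax))) => //.
    by rewrite hK.
- exists (range f) => //.
  have /choice[h hP] : forall x : set_type (range f), exists s, f s = set_val x.
    by move=> x; have /set_mem[s _ fs] := valP x; exists s.
  pose g s : set_type (range f) := SigSub (mem_set (imageT f s)).
  have hg : cancel g h by move=> s; apply: finj; rewrite hP.
  exists h, g; split => //.
  + by move=> x; apply: val_inj; rewrite /= hP.
  + move=> x N /fN[W hxW sub].
    have : nbhs x (set_val @^-1` W).
      by apply: (@initial_continuous _ _ (set_val : range f -> G)); rewrite -hP.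
    by apply: filterS => y Wy; apply: sub => /=; rewrite hP.
  + move=> s N [_ [[W oW <-] /= Wfs sub]].
    apply/fN; exists W; first exact: open_nbhs_nbhs.
    by move=> t Wft; apply: sub.
Qed.

(** A closed embedding reflects local statements at every point of [G]: a
point off the range has a neighbourhood with empty preimage. *)
Lemma closed_embedding_nbhs (f : S -> G) (z : G) (P : set S) :
  embedding f -> closed (range f) -> (forall s, f s = z -> nbhs s P) ->
  exists2 W, nbhs z W & f @^-1` W `<=` P.
Proof.
move=> [finj fN] clf fP; have [[s _ fs]|nz] := pselect (range f z).
  by have /fN := fP s fs; rewrite fs.
exists (~` range f); last by move=> t; case; exists t.
by apply: open_nbhs_nbhs; split => //; apply: closed_openC.
Qed.

End Embedding.

(** * The sequential fan *)

(** Compact sets of natural numbers are bounded. *)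
Lemma nbhs_sequence_limit (N : set convergent_sequence) :
  nbhs (None : convergent_sequence) N <->
  N None /\ \forall m \near \oo, N (Some m).
Proof.
split=> [[K [cK _] KN]|[N0 [k _ kN]]].
- split; first by apply: KN; right.
  have : \forall m \near \oo, K `<=` [set x | (x < m)%N].
    move/compact_near_coveringP: cK; apply => x Kx.
    exists ([set x], [set m | (x < m)%N]).
      split=> /=; last exact: nbhs_infty_gt.
      by rewrite nbhs_principalE; exact/principal_filterP.
    by move=> [y m] [/= -> ].
  apply: filterS => m Km; apply: KN; left; exists m => // /Km /=.
  by rewrite ltnn.
- exists `I_k; first split.
  + exact/finite_compact/finite_II.
  + exact: discrete_closed.
  + move=> _ [[m km <-]|-> //]; apply: kN.
    by rewrite /= leqNgt; apply/negP.
Qed.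

Definition hub : S_omega :=
  @wedge_lift nat (fun=> convergent_sequence) (fun=> None) 0 None.

Definition spoke (n m : nat) : S_omega :=
  @wedge_lift nat (fun=> convergent_sequence) (fun=> None) n (Some m).

Definition fan_map (Z : Type) (a : Z) (y : nat -> nat -> Z) : S_omega -> Z :=
  wedge_fun (fun n (c : convergent_sequence) =>
    if c is Some m then y n m else a).

Lemma hubE n :
  @wedge_lift nat (fun=> convergent_sequence) (fun=> None) n None = hub.
Proof.
exact: (@wedge_liftE nat (fun=> convergent_sequence) (fun=> None)
  0 None n None).
Qed.

Lemma fan_map_hub Z (a : Z) y : fan_map a y hub = a.
Proof. exact: wedge_lift_funE. Qed.

Lemma fan_map_spoke Z (a : Z) y n m : fan_map a y (spoke n m) = y n m.
Proof. exact: wedge_lift_funE. Qed.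

Lemma S_omega_ind (P : S_omega -> Prop) :
  P hub -> (forall n m, P (spoke n m)) -> forall s, P s.
Proof.
move=> Ph Ps s.
have : [set: S_omega] s by [].
rewrite -[setT](@wedgeTE nat (fun=> convergent_sequence) (fun=> None)).
move=> [n _ [[m|] _ <-]]; first exact: Ps.
by rewrite -(hubE n) in Ph.
Qed.

Lemma closed_limit : closed [set (None : convergent_sequence)].
Proof.
rewrite -[X in closed X]setCK; apply: open_closedC.
rewrite (_ : ~` _ = Some @` [set: nat]).
  by apply: one_point_compactification_open_some; exact: openT.
apply/seteqP; split=> [[m|] //= _|_ [m _ <-] //]; first by exists m.
Qed.

Lemma nbhs_hub (N : set S_omega) :
  nbhs hub N <-> N hub /\ forall n, \forall m \near \oo, N (spoke n m).
Proof.
rewrite /hub wedge_point_nbhs; split=> [Nn|[Nh Nn] n _].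
- split; last by move=> n; have /nbhs_sequence_limit[] := Nn n I.
  by have /nbhs_sequence_limit[] := Nn 0 I.
- apply/nbhs_sequence_limit; split; last exact: Nn.
  by rewrite -/hub -(hubE n) in Nh.
Qed.

Lemma nbhs_spoke n m (N : set S_omega) : nbhs (spoke n m) N <-> N (spoke n m).
Proof.
split=> [/nbhs_singleton //|Nnm].
rewrite /spoke -wedge_lift_nbhs //; last exact: closed_limit.
rewrite /nbhs /= /fmap /=.
by rewrite nbhs_principalE; apply/principal_filterP.
Qed.

Lemma spoke_neq_hub n m : spoke n m <> hub.
Proof.
pose F := @fan_map bool false (fun _ _ => true).
by move=> /(congr1 F); rewrite /F fan_map_spoke fan_map_hub.
Qed.

Lemma spoke_inj n m n' m' : spoke n m = spoke n' m' -> (n, m) = (n', m').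
Proof.
by move=> /(congr1 (@fan_map (nat * nat) (0, 0) pair)); rewrite !fan_map_spoke.
Qed.

Lemma fan_map_continuous (G : topologicalType) (a : G) (y : nat -> nat -> G) :
  (forall n, y n @ \oo --> a) -> continuous (fan_map a y).
Proof.
move=> ya; apply: S_omega_ind => [|n m] W.
- rewrite fan_map_hub => aW; apply/nbhs_hub; split=> /= [|n].
    by rewrite fan_map_hub; exact: nbhs_singleton.
  have [k _ kW] := ya n W aW; exists k => // m km /=.
  by rewrite fan_map_spoke; exact: kW.
- by move=> /nbhs_singleton ?; exact/nbhs_spoke.
Qed.

(** * Arens' space *)

Lemma nbhs_arens_xx n m (N : set S_two) :
  nbhs (arens_xx n m : S_two) N <-> N (arens_xx n m).
Proof. by split=> [/nbhs_singleton //|Nnm]; apply/principal_filterP. Qed.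

Lemma nbhs_arens_x n (N : set S_two) :
  nbhs (arens_x n : S_two) N <->
  N (arens_x n) /\ \forall m \near \oo, N (arens_xx n m).
Proof.
split=> [[k _ kN]|[Nn [k _ kN]]].
- split; first by apply: kN; left.
  by exists k.+1 => // m km; apply: kN; right; exists m.
- exists k => // t [-> //|[m /= km <-]].
  by apply: kN; apply: ltnW.
Qed.

Lemma nbhs_arens_infty (N : set S_two) :
  nbhs (arens_infty : S_two) N <->
  N arens_infty /\ \forall n \near \oo, nbhs (arens_x n : S_two) N.
Proof.
split=> [[[k h] _ khN]|[Ninf [k _ kN]]].
- split; first by apply: khN; left.
  exists k.+1 => // n kn; exists (h n) => // t nt.
  by apply: khN; right; exists n.
- have /choice[h hN] : forall n, exists h, (k <= n)%N ->
      arens_basic_x n h `<=` N.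
    move=> n; have [kn|_] := leqP k n; last by exists 0.
    by have [h _ hN] := kN n kn; exists h.
  exists (k, h) => // t [-> //|[n /= kn nt]].
  exact: (hN n (ltnW kn)).
Qed.

Definition arens_map (Z : Type) (a : Z) (x : nat -> Z) (y : nat -> nat -> Z)
    (t : S_two) : Z :=
  match t with
  | arens_infty => a
  | arens_x n => x n
  | arens_xx n m => y n m
  end.

Lemma arens_map_continuous (G : topologicalType) (a : G) x y :
  x @ \oo --> a -> (forall n, y n @ \oo --> x n) -> continuous (arens_map a x y).
Proof.
move=> xa yx [|n|n m] W tW.
- apply/nbhs_arens_infty; split; first exact: (nbhs_singleton tW).
  have [k _ kW] := xa _ (nbhs_interior tW); exists k => // n /kW xW.
  by apply/nbhs_arens_x; split; [exact: (nbhs_singleton xW) | exact: (yx n W xW)].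
- by apply/nbhs_arens_x; split; [exact: (nbhs_singleton tW) | exact: (yx n W tW)].
- by apply/nbhs_arens_xx; exact: (nbhs_singleton tW).
Qed.

(** * Exchanging the two spaces *)

Section Exchange.
Variable G : topologicalType.
Hypotheses (hG : hausdorff_space G) (rG : rectifiable G).

(** The column [C n] is translated from [a] to [x n]; the [x n] are taken in
the column [C 0], far enough to have disjoint neighbourhoods [D n], and an
initial segment of each translated column is dropped to keep it in [D n]. *)
Lemma arens_of_fan (f : S_omega -> G) : embedding f ->
  exists2 g : S_two -> G, embedding g & (closed (range f) -> closed (range g)).
Proof.
move=> ef; have [finj fN] := ef.
pose a := f hub; pose C n m := f (spoke n m).
have [S [T [cS cT [ST TS] Sa aS]]] := rectifiable_translations a rG.
have Tbb b : T (b, b) = a by rewrite -{2}(Sa b) TS.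
have Taz z : T (a, z) = z by rewrite -{1}(aS z) TS.
have Ca n : C n @ \oo --> a.
  by move=> W /(embedding_continuous ef)/nbhs_hub[_ /(_ n)].
have Cna n m : C n m <> a by move=> /finj /spoke_neq_hub.
have Cinj n m n' m' : C n m = C n' m' -> (n, m) = (n', m').
  by move=> /finj /spoke_inj.
have [M [D [hM oD aD Dinj]]] :=
  discrete_selection hG id (fun=> Ca 0) (fun=> Cna 0).
(* M n >= n, so the x n still converge to a. *)
pose x n := C 0 (M n); have xD n : nbhs (x n) (D n) := open_nbhs_nbhs (oD n).
have Dx n : D n (x n) := nbhs_singleton (xD n).
have nDa n : ~ D n a := nbhs_singleton (aD n).
have xa : x @ \oo --> a.
  move=> W /(Ca 0)[N _ NW]; exists N => // n Nn.
  exact/NW/(leq_trans Nn (hM n)).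
have /choice[K KD] : forall n, exists k, forall m, D n (S (x n, C n (k + m))).
  move=> n; have : nbhs (S (x n, a)) (D n) by rewrite Sa; exact: xD.
  move=> /(continuous_pair_slice cS)/(Ca n)[k _ kD]; exists k => m.
  by apply: kD => /=; exact: leq_addr.
pose y n m := S (x n, C n (K n + m)).
have Ty n m : T (x n, y n m) = C n (K n + m) by rewrite TS.
have yx n : y n @ \oo --> x n.
  move=> W; rewrite -{1}(Sa (x n)).
  move=> /(continuous_pair_slice cS)/(Ca n)[k _ kW]; exists k => // m km.
  by apply: kW => /=; apply: leq_trans km _; exact: leq_addl.
have xney n m : x n <> y n m.
  by move=> xy; have := Ty n m; rewrite -xy Tbb => /esym /Cna.
exists (arens_map a x y).
- apply: embeddingP.
  + have Dy n m : D n (y n m) by exact: KD.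
    move=> [|n|n m] [|n'|n' m'] //= E; try by
      [case: (nDa n'); rewrite E | case: (nDa n); rewrite -E].
    * by congr (arens_x _); apply: (Dinj _ _ (x n)); rewrite // E.
    * have nn' : n = n' by apply: (Dinj _ _ (x n)) => //; rewrite E; exact: KD.
      by rewrite nn' in E; case: (xney n' m').
    * have nn' : n = n' by apply: (Dinj _ _ (x n')) => //; rewrite -E; exact: KD.
      by rewrite nn' in E; case: (xney n' m).
    * have nn' : n = n'.
        by apply: (Dinj _ _ (y n m)); [exact: KD | rewrite E; exact: KD].
      rewrite -nn' in E *.
      have := Ty n m; rewrite E Ty => /Cinj[/addnI ->]; by [].
  + exact: arens_map_continuous.
  + move=> [|n|n m] N /=.
    * move=> /nbhs_arens_infty[Ninf [k _ kN]].
      have /choice[h hN] : forall n, exists h, forall m, (k <= n)%N ->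
          N (arens_x n) /\ ((h <= m)%N -> N (arens_xx n m)).
        move=> n; have [kn|_] := leqP k n; last by exists 0.
        have /nbhs_arens_x[Nn [h _ hN]] := kN n kn.
        by exists h => m _; split=> // hm; exact: hN.
      (* The y n m outside N are, up to finitely many columns, among those
         with m < h n; the corresponding points of the fan avoid a
         neighbourhood W of its centre. *)
      have /fN[W aW sub] : nbhs hub [set s | forall n m,
          s = spoke n m -> (K n + h n <= m)%N].
        apply/nbhs_hub; split=> [n m /esym /spoke_neq_hub //|n].
        exists (K n + h n) => // m /= hm n' m' /spoke_inj[<- <-]; exact: hm.
      have : nbhs (T (a, a)) W by rewrite Taz.
      move=> /(continuous_pair_nbhs cT)[U [V [aU aV UVW]]].
      have [k' _ k'U] := xa U aU.
      (* Columns before m0 are excluded by D n; later ones by W. *)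
      pose m0 := maxn k k'.
      exists (V `&` [set z | forall n, (n < m0)%N -> ~ D n z]).
        apply: filterI => //; apply: filter_below => n _.
        exact: aD.
      move=> t /= [Vt nDt].
      have big n : D n (arens_map a x y t) -> (m0 <= n)%N.
        by move=> Dn; rewrite leqNgt; apply/negP => /nDt.
      case: t Vt nDt big => [//|n|n m] /= Vt _ big.
        have /(leq_trans (leq_maxl k k')) kn := big n (Dx n).
        by have [] := hN n 0 kn.
      have m0n := big n (KD n m).
      have kn := leq_trans (leq_maxl k k') m0n.
      have k'n := leq_trans (leq_maxr k k') m0n.
      apply: (hN n m kn).2.
      have := UVW _ _ (k'U n k'n) Vt; rewrite Ty => /sub /= /(_ n _ erefl).
      by rewrite leq_add2l.
    * move=> /nbhs_arens_x[Nn [k _ kN]].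
      have /fN[W aW sub] : nbhs hub [set s | forall m,
          s = spoke n m -> (K n + k <= m)%N].
        apply/nbhs_hub; split=> [m /esym /spoke_neq_hub //|n'].
        exists (K n + k) => // m /= hm m' /spoke_inj[_ <-]; exact: hm.
      exists (D n `&` [set z | W (T (x n, z))]).
        apply: filterI; first exact: xD.
        by apply: (continuous_pair_slice cT); rewrite Tbb.
      move=> t /= [Dt Wt].
      have nt n' : D n' (arens_map a x y t) -> n' = n by move=> /Dinj; apply.
      case: t Dt Wt nt => [/nDa //|n'|n' m] /= _ Wt nt.
        by rewrite (nt n').
      have nn := nt _ (KD n' m); rewrite {}nn in Wt *; apply: kN => /=.
      by move: Wt; rewrite Ty => /sub /= /(_ _ erefl); rewrite leq_add2l.
    * move=> /nbhs_arens_xx Nnm.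
      have /fN[W aW sub] : nbhs (spoke n (K n + m)) [set spoke n (K n + m)].
        exact/nbhs_spoke.
      exists (D n `&` [set z | W (T (x n, z))]).
        apply: filterI.
          by apply: open_nbhs_nbhs; split; [exact: (oD n).1 | exact: KD].
        by apply: (continuous_pair_slice cT); rewrite Ty.
      move=> t /= [Dt Wt].
      have nt n' : D n' (arens_map a x y t) -> n' = n by move=> /Dinj; apply.
      case: t Dt Wt nt => [/nDa //|n'|n' m'] /= _ Wt nt.
        by move: Wt; rewrite (nt n') // Tbb => /sub /= /esym /spoke_neq_hub.
      have nn := nt _ (KD n' m'); rewrite {}nn in Wt *.
      by move: Wt; rewrite Ty => /sub /= /spoke_inj[/addnI ->].
- move=> clf; apply: closedP => z nz.
  have za : z <> a by move=> za; apply: nz; exists arens_infty.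
  (* z may be a point of the fan, isolated there, but in one column only. *)
  have [n0 n0C] : exists n0, forall n m, C n m = z -> (n < n0)%N.
    have [[n [m Cz]]|noC] := pselect (exists n m, C n m = z).
      by exists n.+1 => n' m'; rewrite -Cz => /Cinj[-> _].
    by exists 0 => n m Cz; case: noC; exists n, m.
  have [W zW sub] : exists2 W, nbhs z W &
      f @^-1` W `<=` [set s | forall n m, s = spoke n m -> (n < n0)%N].
    apply: closed_embedding_nbhs => //.
    apply: S_omega_ind => [/esym/za //|n m Cz].
    by apply/nbhs_spoke => n' m' /spoke_inj[<- _]; exact: (n0C n m).
  have : nbhs (T (a, z)) W by rewrite Taz.
  move=> /(continuous_pair_nbhs cT)[U [V [aU zV UVW]]].
  have [k _ kU] := xa U aU.
  pose m0 := maxn n0 k.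
  have zx : nbhs z [set v | forall n, x n <> v].
    by apply: nbhs_avoid_cvg xa za _ => // n xz; apply: nz; exists (arens_x n).
  have zy : nbhs z [set v | forall n, (n < m0)%N -> forall m, y n m <> v].
    apply: filter_below => n _.
    apply: nbhs_avoid_cvg (yx n) _ _ => //.
      by move=> zx'; apply: nz; exists (arens_x n).
    by move=> m yz; apply: nz; exists (arens_xx n m).
  apply: filterS (filterI (nbhs_neq hG za) (filterI zV (filterI zx zy))).
  move=> v [va [Vv [xv yv]]] [[|n|n m] _ /= E]; first by rewrite E in va.
    exact: xv E.
  have [/yv/(_ m)//|m0n] := ltnP n m0.
  have n0n := leq_trans (leq_maxl n0 k) m0n.
  have kn := leq_trans (leq_maxr n0 k) m0n.
  rewrite -E in Vv.
  have := UVW _ _ (kU n kn) Vv; rewrite Ty => /sub /= /(_ n _ erefl).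
  by rewrite ltnNge n0n.
Qed.

(** Every column is translated to [a], and becomes a column converging to [a].
The column [w n] of the fan is a subsequence of the [n]-th one; all the points
[w n j] are selected in one enumeration of the pairs [(n, j)], which makes
them distinct and isolated across columns. *)
Lemma fan_of_arens (g : S_two -> G) : embedding g ->
  exists2 f : S_omega -> G, embedding f & (closed (range g) -> closed (range f)).
Proof.
move=> eg; have [ginj gN] := eg; have gc := embedding_continuous eg.
pose a := g arens_infty; pose x n := g (arens_x n).
have [S [T [cS cT [ST TS] Sa aS]]] := rectifiable_translations a rG.
have Tbb b : T (b, b) = a by rewrite -{2}(Sa b) TS.
have xa : x @ \oo --> a.
  move=> W /gc/nbhs_arens_infty[_ [k _ kW]]; exists k => // n /kW.
  by move=> /nbhs_arens_x[].
pose y n m := T (x n, g (arens_xx n m)).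
have Sy n m : S (x n, y n m) = g (arens_xx n m) by rewrite ST.
have ya n : y n @ \oo --> a.
  move=> W; rewrite -{1}(Tbb (x n)).
  move=> /(continuous_pair_slice cT)/gc/nbhs_arens_x[_ [k _ kW]].
  by exists k => // m /kW.
have yna n m : y n m <> a.
  by move=> ynma; have := Sy n m; rewrite ynma Sa => /ginj.
pose e s : nat * nat := odflt (0, 0) (unpickle s).
have eK p : e (pickle p) = p by rewrite /e pickleK.
(* The point selected at stage pickle (n, j) has index at least j in the column
   n, so that w n converges. *)
have [M [D [hM oD aD Dinj]]] := discrete_selection hG (fun s => (e s).2)
  (fun s => ya (e s).1) (fun s => yna (e s).1).
pose M' (n j : nat) := M (pickle (n, j)); pose w n j := y n (M' n j).
pose D' (n j : nat) := D (pickle (n, j)).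
have wD n j : nbhs (w n j) (D' n j).
  by have := open_nbhs_nbhs (oD (pickle (n, j))); rewrite eK.
have Dw n j : D' n j (w n j) := nbhs_singleton (wD n j).
have aD' n j : nbhs a (~` D' n j) by exact: aD.
have D'inj n j n' j' p : D' n j p -> D' n' j' p -> (n, j) = (n', j').
  by move=> Dp D'p; apply: (pcan_inj pickleK); apply: Dinj Dp D'p.
have M'ge n j : (j <= M' n j)%N by have := hM (pickle (n, j)); rewrite eK.
have wa n : w n @ \oo --> a.
  move=> W /(ya n)[k _ kW]; exists k => // j kj.
  by apply: kW => /=; exact: leq_trans kj (M'ge n j).
have wna n j : w n j <> a by exact: yna.
exists (fan_map a w).
- apply: embeddingP.
  + apply: S_omega_ind => [|n j]; apply: S_omega_ind => [|n' j'] //;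
      rewrite ?fan_map_hub ?fan_map_spoke.
    * by move=> /esym /wna.
    * by move=> /wna.
    * move=> E; suff [-> ->] : (n, j) = (n', j') by [].
      by apply: (D'inj _ _ _ _ (w n j)); rewrite // E.
  + exact: fan_map_continuous.
  + apply: S_omega_ind => [|n j] N; rewrite ?fan_map_hub ?fan_map_spoke.
    * move=> /nbhs_hub[Nh /(_ _)/cid2/= Nk].
      have /choice[k kN] : forall n, exists k, forall j,
          (k <= j)%N -> N (spoke n j).
        by move=> n; have [k _ kN] := Nk n; exists k.
      (* The w n j with j < k n come from points of S_two whose indices in
         the n-th column are at most F n. *)
      pose F n := \max_(j < k n) M' n j.
      have FM n j : (F n < M' n j)%N -> (k n <= j)%N.
        rewrite ltnNge; apply: contraR; rewrite -ltnNge => jk.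
        exact: (leq_bigmax_cond (Ordinal jk)).
      have /gN[W aW sub] : nbhs (arens_infty : S_two)
          [set t | forall n m, t = arens_xx n m -> (F n < m)%N].
        apply/nbhs_arens_infty; split=> //; exists 0 => // n _.
        apply/nbhs_arens_x; split=> //; exists (F n).+1 => // m Fm n' m' [<- <-].
        exact: Fm.
      have : nbhs (S (a, a)) W by rewrite Sa.
      move=> /(continuous_pair_nbhs cS)[U [V [aU aV UVW]]].
      have [n0 _ n0U] := xa U aU.
      exists (V `&` [set z | forall n, (n < n0)%N -> forall j, (j < k n)%N ->
          ~ D' n j z]).
        apply: filterI => //; apply: filter_below => n _.
        apply: (@filter_below _ _ (fun j => ~` D' n j)) => j _; exact: aD'.
      apply: S_omega_ind => [//|n j] /=; rewrite fan_map_spoke => -[Vw nDw].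
      apply: kN; have [nn0|n0n] := ltnP n n0.
        by rewrite leqNgt; apply/negP => /(nDw n nn0 j).
      apply: FM; have := UVW _ _ (n0U n n0n) Vw; rewrite Sy => /sub; exact.
    * move=> /nbhs_spoke Nnj; exists (D' n j) => //.
      apply: S_omega_ind => [|n' j'] /=; rewrite ?fan_map_hub ?fan_map_spoke.
        by move=> Da; have /(_ Da) := nbhs_singleton (aD' n j).
      by move=> Dw'; have [-> ->] := D'inj _ _ _ _ _ (Dw n' j') Dw'.
- move=> clg; apply: closedP => z nz.
  have za : z <> a by move=> za; apply: nz; exists hub; rewrite ?fan_map_hub.
  have [[U V] /= [zU aV UV]] := hausdorff_separate hG za.
  have /choice[k kV] : forall n, exists k, forall j, (k <= j)%N -> V (w n j).
    by move=> n; have [k _ kV] := wa n V aV; exists k.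
  (* Inside U only the w n j with j < k n remain. *)
  pose F n := \max_(j < k n) M' n j.
  have FM n j : (F n < M' n j)%N -> (k n <= j)%N.
    rewrite ltnNge; apply: contraR; rewrite -ltnNge => jk.
    exact: (leq_bigmax_cond (Ordinal jk)).
  (* z may be one of the isolated points of S_two, in one column only. *)
  have [n1 n1g] : exists n1, forall n m, g (arens_xx n m) = z -> (n < n1)%N.
    have [[n [m gz]]|nog] := pselect (exists n m, g (arens_xx n m) = z).
      by exists n.+1 => n' m'; rewrite -gz => /ginj[-> _].
    by exists 0 => n m gz; case: nog; exists n, m.
  have [W zW sub] : exists2 W, nbhs z W & g @^-1` W `<=`
      [set t | forall n m, t = arens_xx n m -> (n < n1)%N \/ (F n < m)%N].
    apply: closed_embedding_nbhs => // t gt.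
    have nx n : nbhs (arens_x n : S_two)
      [set t | forall n m, t = arens_xx n m -> (n < n1)%N \/ (F n < m)%N].
      apply/nbhs_arens_x; split=> //; exists (F n).+1 => // m Fm n' m' [<- <-].
      by right; exact: Fm.
    case: t gt => [_|n _|n m gt].
    + by apply/nbhs_arens_infty; split=> //; exists 0 => // n _; exact: nx.
    + exact: nx.
    + by apply/nbhs_arens_xx => n' m' [<- <-]; left; exact: n1g gt.
  have : nbhs (S (a, z)) W by rewrite aS.
  move=> /(continuous_pair_nbhs cS)[U1 [U2 [aU1 zU2 UUW]]].
  have [n0 _ n0U] := xa U1 aU1.
  have zw : nbhs z [set v | forall n, (n < maxn n0 n1)%N ->
      forall j, w n j <> v].
    apply: filter_below => n _; apply: (nbhs_avoid_cvg hG (wa n) za) => j wz.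
    by apply: nz; exists (spoke n j); rewrite ?fan_map_spoke.
  apply: filterS (filterI (nbhs_neq hG za) (filterI zU (filterI zU2 zw))).
  move=> v [va [Uv [U2v wv]]] [s _]; elim/S_omega_ind: s => [|n j].
    by rewrite fan_map_hub => /esym.
  rewrite fan_map_spoke => E; have [/wv/(_ j)//|] := ltnP n (maxn n0 n1).
  rewrite geq_max => /andP[n0n n1n]; rewrite -E in U2v Uv.
  have := UUW _ _ (n0U n n0n) U2v; rewrite Sy => /sub /= /(_ n _ erefl) [].
    by rewrite ltnNge n1n.
  by move=> /FM /kV; exact: UV.
Qed.

End Exchange.

Theorem theorem4p1 (G : topologicalType)
    (T1_G : accessible_space G) (regular_G : regular_space G)
    (rectifiable_G : rectifiable G) :
  (has_copy S_omega G <-> has_copy S_two G) /\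
  (has_closed_copy S_omega G <-> has_closed_copy S_two G).
Proof.
have hG := T1_regular_hausdorff T1_G regular_G.
have has_copyE S : has_copy S G <-> exists f : S -> G, embedding f.
  split=> [[A SA]|[f ef]].
    have [|f ef _] := (copy_embedding S (fun _ : set G => True)).1.
      by exists A.
    by exists f.
  have [|A _ SA] := (copy_embedding S (fun _ : set G => True)).2.
    by exists f.
  by exists A.
split; split.
- move=> /has_copyE[f /(arens_of_fan hG rectifiable_G)[g eg _]].
  by apply/has_copyE; exists g.
- move=> /has_copyE[g /(fan_of_arens hG rectifiable_G)[f ef _]].
  by apply/has_copyE; exists f.
- move=> /copy_embedding[f /(arens_of_fan hG rectifiable_G)[g eg clg] clf].
  by apply/copy_embedding; exists g => //; exact: clg.
- move=> /copy_embedding[g /(fan_of_arens hG rectifiable_G)[f ef clf] clg].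
  by apply/copy_embedding; exists f => //; exact: clf.
Qed.
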